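(* Let $\alpha$ be a constant with $1/2<\alpha<1$. Then the diameter of a random Cayley digraph of order $n$ and degree $\lfloor n^{\alpha}\rfloor$ is asymptotically almost surely equal to two. That is, for every $\varepsilon>0$ there exists $N$ such that for every finite group $G$ of order $n\ge N$, if $S$ is a uniformly random subset of $G\setminus\{1\}$ of size $\lfloor n^{\alpha}\rfloor$, then $$\Pr\big(\operatorname{diam}(\operatorname{Cay}(G,S))=2\big)\ge 1-\varepsilon .$$
   Context: For a finite group $G$ and a subset $S\subseteq G\setminus\{1\}$, the Cayley digraph $\operatorname{Cay}(G,S)$ has vertex set $G$ and arc set $\{(g,gs): g\in G, s\in S\}$. The distance from $g$ to $h$ is the length of the shortest directed path from $g$ to $h$ (infinite if there is none). The diameter $\operatorname{diam}(\operatorname{Cay}(G,S))$ is the smallest integer $d$ such that for every ordered pair $(g,h)$ the distance from $g$ to $h$ is at most $d$ (and is $\infty$ if no such $d$ exists). A random Cayley digraph of order $n$ and degree $k$, $1\le k\le n-1$, is $\operatorname{Cay}(G,S)$ where $G$ is an arbitrary group of order $n$ and $S$ is chosen uniformly among all $k$-element subsets of $G\setminus\{1\}$. *)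

(* Defs.v *)
From mathcomp Require Import all_boot all_order all_algebra all_fingroup.
From mathcomp Require Import all_classical all_reals all_analysis.

Set Implicit Arguments.
Unset Strict Implicit.
Unset Printing Implicit Defensive.

Import Order.TTheory GRing.Theory Num.Theory.

Local Open Scope ring_scope.

Definition cayley_digraph (gT : finGroupType) (S : {set gT}) : rel gT :=
  [rel g h | [exists s in S, h == (g * s)%g]].

(* [p] lists the vertices of the path after [g], so that the number of arcs
   of the path is [size p]. *)
Definition dipath (T : finType) (e : rel T) (g h : T) (p : seq T) : bool :=
  [&& path e g p, uniq (g :: p) & last g p == h].

(* Distances and diameters are extended reals; [ereal_inf set0 = +oo], and the
   infimum of a nonempty set of natural numbers is its least element. *)
Definition distance (R : realType) (T : finType) (e : rel T) (g h : T)
    : \bar R :=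
  ereal_inf [set (size p)%:R%:E | p in [set p | dipath e g h p]]%classic.

Definition diameter (R : realType) (T : finType) (e : rel T) : \bar R :=
  ereal_inf [set d%:R%:E
    | d in [set d : nat | forall g h : T,
                            (distance R e g h <= d%:R%:E)%E]]%classic.

Definition connection_sets (gT : finGroupType) (k : nat) : {set {set gT}} :=
  [set S : {set gT} | (S \subset [set~ 1%g]) && (#|S| == k)].

Definition uniform_Pr (R : realType) (T : finType) (A : {set T}) (E : pred T)
    : R :=
  #|[set x in A | E x]|%:R / #|A|%:R.

(* Main.v *)
(* Fix x <> 1 and reveal a uniform k-subset S of G \ {1} in two halves, first
   A with |A| = k/2, then the rest. If x is not a product of two elements of S,
   then S avoids the elements a^-1 x (a in A), so at least k/2 - 1 of the
   n - 1 - k/2 elements still available are forbidden to the second half. This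
   has probability at most (1 - (k/2 - 1)/n)^(k/2), roughly
   exp(- n^(2 alpha - 1) / 4), which beats the union bound over the n choices
   of x because 2 alpha > 1. On the complement every x <> 1 is a product of two
   elements of S, so the diameter is at most 2, and it exceeds 1 because
   k < n - 1. *)
Require Import Defs.
From mathcomp Require Import all_boot all_order all_algebra all_fingroup.
From mathcomp Require Import all_classical all_reals all_analysis.
From mathcomp Require Import zify ring lra.
Set Implicit Arguments.
Unset Strict Implicit.
Import Order.TTheory GRing.Theory Num.Theory.

(** * Counting families of [k]-sets through their [a]-subsets *)

Lemma mul_bin_bin n k a : a <= k <= n ->
  'C(n, k) * 'C(k, a) = 'C(n, a) * 'C(n - a, k - a).
Proof.
case/andP=> ak kn.
have := bin_fact kn; have := bin_fact ak.
have := bin_fact (leq_trans ak kn); have := bin_fact (leq_sub2r a kn).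
have -> : (n - a - (k - a) = n - k)%N by lia.
move=> e1 e2 e3 e4.
(* Multiplied by [a! (k - a)! (n - k)!], both sides become [n!]. *)
apply/eqP; rewrite -(eqn_pmul2r (fact_gt0 a)) -(eqn_pmul2r (fact_gt0 (k - a))).
rewrite -(eqn_pmul2r (fact_gt0 (n - k))); apply/eqP.
transitivity (n`!).
  by rewrite -e4 -e3; ring.
by rewrite -e2 -e1; ring.
Qed.

(** The comparison is factor by factor: [(M - b)(M - t)] exceeds [M (M - t - b)] by [b t], or the
    latter is 0 by truncation. *)
Lemma ffact_subl_expn_le M t b :
  (M - t) ^_ b * M ^ b <= M ^_ b * (M - t) ^ b.
Proof.
elim: b => [|b IHb]; first by rewrite !ffactn0.
rewrite !ffactnSr !expnSr.
rewrite (_ : _ * _ * _ = ((M - t) ^_ b * M ^ b) * ((M - t - b) * M)); last by ring.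
rewrite (_ : M ^_ b * _ * _ = (M ^_ b * (M - t) ^ b) * ((M - b) * (M - t))); last by ring.
by apply: leq_mul => //; nia.
Qed.

Lemma bin_subl_expn_le M t b :
  'C(M - t, b) * M ^ b <= 'C(M, b) * (M - t) ^ b.
Proof.
rewrite -(leq_pmul2r (fact_gt0 b)) mulnAC bin_ffact.
by rewrite [leqRHS]mulnAC bin_ffact ffact_subl_expn_le.
Qed.

(* Both sides bound the number of pairs (A, S) with A \subset S, S \in F and
   #|A| = a; for fixed A, S is determined by S :\: A. *)
Lemma double_count_subsets (T : finType) (U : {set T}) (F : {set {set T}})
    (W : {set T} -> {set T}) (k a m : nat) :
  (forall S, S \in F -> (S \subset U) && (#|S| == k)) ->
  (forall S A : {set T}, S \in F -> A \subset S -> #|A| = a ->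
     (S :\: A \subset W A) /\ (#|W A| <= m)) ->
  #|F| * 'C(k, a) <= 'C(#|U|, a) * 'C(m, k - a).
Proof.
move=> FU FW.
have -> : #|F| * 'C(k, a) =
    \sum_(S in F) \sum_(A : {set T} | (A \subset S) && (#|A| == a)) 1.
  rewrite -sum_nat_const; apply: eq_bigr => S /FU /andP[_ /eqP <-].
  by rewrite sum1dep_card -cards_draws.
rewrite (exchange_big_dep (fun A : {set T} => (A \subset U) && (#|A| == a))) /=; last first.
  by move=> S A /FU /andP[SU _] /andP[AS ->]; rewrite (fintype.subset_trans AS SU).
rewrite -cards_draws -sum_nat_const.
rewrite [leqRHS](eq_bigl (fun A : {set T} => (A \subset U) && (#|A| == a))); last first.
  by move=> A; rewrite inE.
apply: leq_sum => A /andP[AU /eqP cA].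
rewrite sum1dep_card.
set E := [set _ | _].
(* The bound on [#|W A|] is available only if some [S] in [F] contains [A]; otherwise there is
   nothing to count. *)
have [->|[S0 ES0]] := set_0Vmem E; first by rewrite cards0.
have Wm : #|W A| <= m.
  by move: ES0; rewrite inE => /and3P[FS0 AS0 _]; case: (FW _ _ FS0 AS0 cA).
apply: (@leq_trans 'C(#|W A|, k - a)); last exact: leq_bin2l.
rewrite -cards_draws.
rewrite -(@card_in_imset _ _ (fun S => S :\: A)); last first.
  move=> S S'; rewrite !inE => /and3P[_ AS _] /and3P[_ AS' _] eS.
  by rewrite -(finset.setID S A) -(finset.setID S' A) eS (finset.setIidPr AS) (finset.setIidPr AS').
apply/subset_leq_card/fintype.subsetP => _ /imsetP[S + ->].
rewrite !inE => /and3P[FS AS _].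
have [-> _] := FW _ _ FS AS cA.
have /andP[_ /eqP cS] := FU _ FS.
by rewrite cardsDS // cS cA eqxx.
Qed.

(** Since ['C(#|U|, a) / 'C(k, a) = 'C(#|U|, k) / 'C(#|U| - a, k - a)], the double count bounds the
    share of [F] among all [k]-subsets of [U] by a ratio of binomials, hence by
    [(1 - t / (#|U| - a)) ^ (k - a)]. Denominators are cleared to stay in [nat]. *)
Lemma card_family_expn_le (T : finType) (U : {set T}) (F : {set {set T}})
    (W : {set T} -> {set T}) (k a t : nat) :
  a <= k <= #|U| ->
  (forall S, S \in F -> (S \subset U) && (#|S| == k)) ->
  (forall S A : {set T}, S \in F -> A \subset S -> #|A| = a ->
     (S :\: A \subset W A) /\ (#|W A| <= #|U| - a - t)) ->
  #|F| * (#|U| - a) ^ (k - a) <= 'C(#|U|, k) * (#|U| - a - t) ^ (k - a).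
Proof.
move=> akU FU FW.
have := double_count_subsets FU FW.
have := bin_subl_expn_le (#|U| - a) t (k - a).
have := mul_bin_bin akU.
have : 0 < 'C(k, a) by rewrite bin_gt0; case/andP: akU.
have : 0 < 'C(#|U| - a, k - a) by rewrite bin_gt0; case/andP: akU; lia.
set x := #|F|; set c1 := 'C(k, a); set c2 := 'C(#|U| - a, k - a).
set c3 := 'C(#|U|, a); set c4 := 'C(_, k - a); set c5 := 'C(_, k).
set y := _ ^ _; set z := _ ^ _.
move=> c2_gt0 c1_gt0 e h1 h2.
rewrite -(leq_pmul2r c1_gt0) -(leq_pmul2r c2_gt0).
apply: (@leq_trans (c3 * c4 * (y * c2))).
  by rewrite (_ : x * _ * _ * _ = x * c1 * (y * c2)) ?leq_mul2r ?h2 ?orbT //; ring.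
rewrite (_ : c5 * z * c1 * c2 = c3 * c2 * (c2 * z)); last by rewrite -e; ring.
rewrite (_ : c3 * c4 * _ = c3 * c2 * (c4 * y)); last by ring.
by rewrite leq_mul2l h1 orbT.
Qed.

(** * The probability of missing a fixed product *)

Local Open Scope ring_scope.

(** The sets counted are those with [x] outside [S * S]. [card_family_expn_le] applies with
    [a = k./2] and [t = a.-1], [W A] being the elements still open to the second half of [S]. *)
Lemma product_free_le (R : realType) (gT : finGroupType) (k : nat) (x : gT) :
  (k < #|gT|)%N ->
  #|[set S in connection_sets gT k | [forall s in S, (s^-1 * x)%g \notin S]]|%:R
    <= #|connection_sets gT k|%:R *
       expR (- ((k./2.-1 * (k - k./2))%:R / #|gT|%:R)) :> R.
Proof.
move=> kn.
set F := [set S in _ | _].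
pose U : {set gT} := [set~ 1%g].
have cU : #|U| = #|gT|.-1 by rewrite cardsC1.
pose W (A : {set gT}) := (U :\: A) :\: [set (a^-1 * x)%g | a in A].
have FU S : S \in F -> (S \subset U) && (#|S| == k).
  by rewrite !inE => /andP[].
set a := k./2; set t := a.-1; set b := (k - a)%N.
have ak : (a <= k)%N by rewrite /a; lia.
have aM : (t <= #|U| - a)%N by rewrite cU /t /a; lia.
have FW (S A : {set gT}) : S \in F -> A \subset S -> #|A| = a ->
    S :\: A \subset W A /\ (#|W A| <= #|U| - a - t)%N.
  move=> FS AS cA.
  move: (FS); rewrite !inE => /andP[/andP[SU _] /'forall_implyP Sx].
  have nT y : y \in S -> y \notin [set (a^-1 * x)%g | a in A].
    move=> yS; apply/negP => /imsetP[s sA ys].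
    by move: (Sx s (fintype.subsetP AS _ sA)); rewrite -ys yS.
  split.
    apply/fintype.subsetP => y; rewrite finset.in_setD => /andP[yA yS].
    by rewrite finset.in_setD nT // finset.in_setD yA (fintype.subsetP SU).
  have AU : A \subset U := fintype.subset_trans AS SU.
  (* 1 is removed because it does not lie in U; it is hit when x \in A. *)
  pose B := [set (a^-1 * x)%g | a in A] :\ 1%g.
  have BUA : B \subset U :\: A.
    apply/fintype.subsetP => y; rewrite finset.in_setD1 => /andP[y1 yI].
    rewrite !inE y1 andbT; apply/negP => yA.
    by move: (nT y (fintype.subsetP AS _ yA)); rewrite yI.
  have cB : (t <= #|B|)%N.
    have := cardsD1 1%g [set (a^-1 * x)%g | a in A].
    rewrite -/B card_imset; last by move=> u v /mulIg /invg_inj.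
    by rewrite cA /t => ->; case: (_ \in _); rewrite ?leq_pred.
  rewrite (_ : W A = (U :\: A) :\: B); last first.
    apply/setP => y; rewrite !inE; case: (y == 1%g) => //=.
    by rewrite !andbF.
  by rewrite cardsDS // cardsDS // cA leq_sub2l.
have akU : (a <= k <= #|U|)%N by rewrite ak cU; lia.
have := card_family_expn_le akU FU FW.
rewrite (_ : #|connection_sets gT k| = 'C(#|U|, k)); last first.
  by rewrite -cards_draws.
rewrite -/b.
set M := (#|U| - a)%N.
move=> h.
(* The next steps divide by [M ^ b]; if [M = 0] then [b = 0] and the exponential factor is 1. *)
have [M0|M_gt0] := posnP M.
  have b0 : b = 0%N by rewrite /b; move: M0 akU ak; rewrite /M; lia.
  move: h; rewrite b0 !expn0 !muln1 muln0 mul0r oppr0 expR0 mulr1.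
  by rewrite ler_nat.
have MR : 0 < M%:R :> R by rewrite ltr0n.
have {}h : #|F|%:R * M%:R ^+ b <= 'C(#|U|, k)%:R * (M - t)%:R ^+ b :> R.
  by rewrite -!natrX -!natrM ler_nat.
rewrite -ler_pdivlMr ?exprn_gt0 // in h.
apply: (le_trans h).
rewrite -mulrA -expr_div_n ler_wpM2l //.
rewrite natrM.
have -> : - (t%:R * b%:R / #|gT|%:R) = b%:R * (- (t%:R / #|gT|%:R)) :> R by ring.
rewrite expRM_natl.
apply: lerXn2r; rewrite ?nnegrE ?expR_ge0 ?divr_ge0 //.
(* With [n = #|gT|], this is [1 - t / M <= 1 - t / n <= expR (- (t / n))], using [M <= n]. *)
apply: le_trans (expR_ge1Dx _).
rewrite natrB // mulrBl divff ?gt_eqF // lerD2l lerN2.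
rewrite ler_wpM2l // lef_pV2 ?posrE ?ltr0n // ?ler_nat; first by lia.
by apply/card_gt0P; exists 1%g.
Qed.

(** * Distances and the diameter *)

Lemma distance_le_size (R : realType) (T : finType) (e : rel T) (g h : T)
    (p : seq T) (d : nat) :
  dipath e g h p -> (size p <= d)%N -> (distance R e g h <= d%:R%:E)%E.
Proof.
move=> ep pd; apply: ge_ereal_inf; exists (size p)%:R%:E; first by exists p.
by rewrite lee_fin ler_nat.
Qed.

Lemma distance_ge2 (R : realType) (T : finType) (e : rel T) (g h : T) :
  g != h -> ~~ e g h -> (2%:E <= distance R e g h)%E.
Proof.
move=> gh egh; apply/ereal_infP => _ [p /= ep <-].
rewrite lee_fin ler_nat; move: ep; rewrite /dipath.
case: p => [|a [|b p]] //=; first by rewrite (negPf gh).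
by case/and3P => /andP[ega _] _ /eqP ah; rewrite -ah ega in egh.
Qed.

Lemma diameter_cayley_digraph_eq2 (R : realType) (gT : finGroupType)
    (S : {set gT}) :
  S \subset [set~ 1%g] -> (#|S| < #|gT|.-1)%N ->
  (forall x, x != 1%g -> exists2 s, s \in S & (s^-1 * x)%g \in S) ->
  diameter R (cayley_digraph S) = 2%:E.
Proof.
move=> S1 cS SS; apply/eqP; rewrite eq_le; apply/andP; split.
  apply: ge_ereal_inf; exists 2%:R%:E => //; exists 2%N => //= g h.
  have [<-|gh] := eqVneq g h.
    by apply: (@distance_le_size _ _ _ _ _ [::]); rewrite // /dipath /= eqxx.
  have [s sS tS] := SS (g^-1 * h)%g ltac:(by rewrite -eq_mulVg1).
  apply: (@distance_le_size _ _ _ _ _ [:: (g * s)%g; h]) => //.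
  have S_neq1 u : u \in S -> u != 1%g.
    by move/(fintype.subsetP S1); rewrite !inE.
  (* The three vertices must be distinct: [g != g * s] and [g * s != h] because neither generator is
     1. *)
  rewrite /dipath /= !inE eqxx !andbT negb_or gh andbT.
  rewrite -(inj_eq (mulgI g^-1)%g) mulKg mulVg eq_sym S_neq1 //=.
  rewrite -andbA; apply/and3P; split.
  - by apply/existsP; exists s; rewrite sS eqxx.
  - apply/existsP; exists (s^-1 * (g^-1 * h))%g; rewrite tS /=.
    by rewrite -mulgA mulKVg mulKVg.
  - by rewrite -(inj_eq (mulgI g^-1)%g) mulKg eq_mulVg1 S_neq1.
apply/ereal_infP => _ [d /= dd <-].
(* Some non-identity [h] is not a generator, so no arc joins 1 to [h]. *)
have [h] : exists h, h \in [set~ 1%g] :\: S.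
  by apply/card_gt0P; rewrite cardsDS // cardsC1 subn_gt0.
rewrite !inE => /andP[hS h1].
apply: le_trans (dd 1%g h); apply: distance_ge2; first by rewrite eq_sym.
by apply/existsP => -[s /andP[sS]]; rewrite mul1g => /eqP hs; rewrite hs sS in hS.
Qed.

(** * Asymptotic estimates *)

Lemma truncn_powR_ltn (R : realType) (alpha : R) : alpha < 1 ->
  exists N : nat, forall n : nat, (N <= n)%N ->
    (Num.truncn (n%:R `^ alpha) < n.-1)%N.
Proof.
move=> a1; have a1_gt0 : 0 < 1 - alpha by lra.
(* This threshold forces [n]^ (1 - alpha) >= 2[, so]n [^ alpha <= n / 2 < n - 1]. *)
exists (4 + (Num.truncn (2 `^ (1 - alpha)^-1 : R)).+1)%N => n Nn.
have n4 : (4 <= n)%N := leq_trans (leq_addr _ _) Nn.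
have x4 : 4 <= n%:R :> R by rewrite ler_nat.
have x0 : 0 < n%:R :> R by lra.
have x2 : 2 `^ (1 - alpha)^-1 <= n%:R :> R.
  by apply/ltW/(lt_le_trans (truncnS_gt _)); rewrite ler_nat (leq_trans _ Nn) ?leq_addl.
have h : 2 <= n%:R `^ (1 - alpha) :> R.
  have := ge0_ler_powR (ltW a1_gt0) _ _ x2.
  rewrite !nnegrE powR_ge0 -powRrM mulVf ?gt_eqF // powRr1 //.
  by apply.
have e : n%:R `^ (1 - alpha) * n%:R `^ alpha = n%:R :> R.
  by rewrite -powRD ?subrK ?powRr1 // gt_eqF // implybT.
have q0 : 0 <= n%:R `^ alpha :> R by exact: powR_ge0.
rewrite truncn_lt_nat // -subn1 natrB; last by lia.
by nra.
Qed.

(** The factors are at least [(q - 4) / 2] and [(q - 1) / 2], both at least [q / 4] once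
    [q >= 12]. *)
Lemma half_expn_ge (R : realType) (q : R) (k : nat) : 12 <= q -> q - 1 <= k%:R ->
  q ^+ 2 / 16 <= (k./2.-1 * (k - k./2))%:R.
Proof.
move=> q12 qk; rewrite natrM.
have : k%:R <= 2 * k./2.-1%:R + 3 :> R.
  by rewrite -[2]/(2%:R) -[3]/(3%:R) -natrM -natrD ler_nat; lia.
have : k%:R <= 2 * (k - k./2)%:R :> R.
  by rewrite -[2]/(2%:R) -natrM ler_nat; lia.
by move=> h1 h2; nra.
Qed.

Lemma union_bound_small (R : realType) (alpha eps : R) :
  1 / 2 < alpha -> 0 < eps ->
  exists N : nat, forall n k : nat, (N <= n)%N -> k = Num.truncn (n%:R `^ alpha) ->
    n%:R * expR (- ((k./2.-1 * (k - k./2))%:R / n%:R)) <= eps.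
Proof.
move=> ha eps0.
set beta := 2 * alpha - 1; have beta0 : 0 < beta by rewrite /beta; lra.
(* With x = n and y = x^beta / 16, the bound exp y >= y^(m+1) / (m+1)! gives
   x exp (- y) <= C / x as soon as beta (m+1) >= 2. *)
set m := Num.truncn (2 / beta).
have mbeta : 2 <= beta * m.+1%:R.
  by rewrite mulrC -ler_pdivrMr // ltW // truncnS_gt.
set C : R := 16 ^+ m.+1 * (m.+1)`!%:R.
have C0 : 0 < C by rewrite mulr_gt0 ?exprn_gt0 // ltr0n fact_gt0.
(* The summand [144 = 12 ^ 2] yields [q >= 12], as [q ^+ 2 >= n]; the other yields
   [C / n <= eps]. *)
exists (144 + (Num.truncn (C / eps)).+1)%N => n k Nn ->.
have xC : C / eps <= n%:R :> R.
  by apply/ltW/(lt_le_trans (truncnS_gt _)); rewrite ler_nat (leq_trans _ Nn) ?leq_addl.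
have x144 : 144 <= n%:R :> R by rewrite ler_nat (leq_trans (leq_addr _ _) Nn).
set q := n%:R `^ alpha.
(* Of the truncation only [q < k + 1] is kept. *)
have := truncnS_gt q; rewrite -natr1.
move: (Num.truncn _) => {}k qk.
move: xC x144 @q qk; set x : R := n%:R => xC x144 q qk.
have x0 : 0 < x by lra.
have q2 : q ^+ 2 = x * x `^ beta.
  rewrite -{1}[x]powRr1 ?ltW // -powRD; last by rewrite (gt_eqF x0) implybT.
  by rewrite -powR_mulrn ?powR_ge0 // -powRrM /beta; congr (_ `^ _); ring.
have xb1 : 1 <= x `^ beta.
  by rewrite -[1](powRr0 x); apply: ler_powR; lra.
have q0 : 0 <= q by exact: powR_ge0.
have q144 : 144 <= q ^+ 2 by rewrite q2 (le_trans x144) // ler_peMr // ltW.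
have q12 : 12 <= q by nra.
have := half_expn_ge q12 (_ : q - 1 <= k%:R).
move=> /(_ ltac:(lra)); set tb : R := (_ * _)%N%:R => tbq.
set y := x `^ beta / 16.
have y0 : 0 <= y by rewrite /y; lra.
have ytb : y <= tb / x by rewrite ler_pdivlMr // (le_trans _ tbq) // q2 /y mulrAC [x * _]mulrC.
have : expR (- (tb / x)) <= expR (- y) by rewrite ler_expR lerN2.
rewrite -(ler_pM2l x0) => /le_trans; apply.
rewrite expRN -[_ * _]/(x / expR y) ler_pdivrMr ?expR_gt0 //.
have := ler_wpM2l (ltW eps0) (expR_ge1Dxn m y0).
apply: le_trans.
have xm : x ^+ 2 <= (x `^ beta) ^+ m.+1.
  rewrite -[X in _ <= X]powR_mulrn ?powR_ge0 // -powRrM -(powR_mulrn _ (ltW x0)).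
  by apply: ler_powR => //; lra.
rewrite /y expr_div_n -mulrA -invfM -/C mulrDr mulr1.
have : x <= eps * (x ^+ 2 / C).
  rewrite mulrA ler_pdivlMr // expr2 mulrA mulrC ler_wpM2r ?(ltW x0) //.
  by move: xC; rewrite ler_pdivrMr // mulrC.
have : eps * (x ^+ 2 / C) <= eps * ((x `^ beta) ^+ m.+1 / C).
  by rewrite ler_wpM2l ?ler_wpM2r ?invr_ge0 // ltW.
lra.
Qed.

Theorem theorem4p7 (R : realType) (alpha : R) :
  1 / 2 < alpha -> alpha < 1 ->
  forall eps : R, 0 < eps ->
  exists N : nat, forall gT : finGroupType, (N <= #|gT|)%N ->
    1 - eps <=
      uniform_Pr R
        (connection_sets gT (Num.truncn (#|gT|%:R `^ alpha)))
        (fun S : {set gT} => diameter R (cayley_digraph S) == 2%:E).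
Proof.
move=> alpha_gt alpha_lt eps eps_gt0.
have [N1 kN1] := truncn_powR_ltn alpha_lt.
have [N2 kN2] := union_bound_small alpha_gt eps_gt0.
exists (N1 + N2)%N => gT Nn.
have {kN1} := kN1 _ (leq_trans (leq_addr _ _) Nn).
have {kN2} := kN2 _ _ (leq_trans (leq_addl _ _) Nn) erefl.
move: (Num.truncn _) => k le_eps ltk.
rewrite /uniform_Pr; set D := connection_sets gT k.
set good := [set S in D | _].
pose bad x := [set S in D | [forall s in S, (s^-1 * x)%g \notin S]].
(* Non-emptiness of [D] makes the quotient in [uniform_Pr] a genuine division. *)
have D_gt0 : 0 < #|D|%:R :> R.
  by rewrite ltr0n cards_draws bin_gt0 cardsC1 ltnW.
have cover : D :\: good \subset \bigcup_(x | x != 1%g) bad x.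
  apply/fintype.subsetP => S; rewrite !finset.in_set => /andP[ngood SD].
  rewrite SD /= in ngood; move/andP: SD => [S1 /eqP cS].
  apply: contraR ngood => /finset.bigcupP nbad.
  apply/eqP/diameter_cayley_digraph_eq2 => //; first by rewrite cS.
  move=> x x1; have /existsP[s /andP[sS sx]] :
      [exists s, (s \in S) && ((s^-1 * x)%g \in S)].
    apply: contra_notT nbad => /existsPn h; exists x => //.
    rewrite /bad /D /connection_sets !finset.in_set S1 cS eqxx /=; apply/'forall_implyP => s sS.
    by have := h s; rewrite sS.
  by exists s.
have bad_le : #|D :\: good|%:R <= eps * #|D|%:R :> R.
  apply: (@le_trans _ _ (\sum_(x : gT | x != 1%g) #|bad x|%:R)).
    rewrite -natr_sum ler_nat.
    apply: leq_trans (subset_leq_card cover) _.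
    elim/big_ind2: _ => // [|A i B j Ai Bj]; first by rewrite cards0.
    by rewrite (leq_trans (leq_card_setU _ _).1) ?leq_add.
  have kn : (k < #|gT|)%N by apply: leq_trans ltk (leq_pred _).
  apply: le_trans (ler_sum _ (fun x _ => product_free_le R x kn)) _.
  (* The summand does not depend on [x], and at most [#|gT|] values of [x] occur. *)
  rewrite sumr_const -/D -[_ *+ #|_|]mulr_natl mulrCA [leLHS]mulrC ler_wpM2r //.
  apply: le_trans le_eps; rewrite ler_wpM2r ?expR_ge0 // ler_nat.
  exact: max_card.
rewrite ler_pdivlMr // mulrBl mul1r lerBlDr.
have goodD : good \subset D by apply/fintype.subsetP => S; rewrite inE => /andP[].
rewrite -(cardsID good D) (finset.setIidPr goodD) natrD lerD2l.
by rewrite -natrD -{2}(finset.setIidPr goodD) cardsID.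
Qed.
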